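(* Let $D=\operatorname{diag}(\lambda_1,\dots,\lambda_n)$ with $\lambda_1>\dots>\lambda_n$, let $\pi\in S_n$, $C\in\mathfrak{lo}$ and $M_0\in\mathcal U^{\mathbf{GL}}_{D^\pi}$. The solution of $$\dot M=[M,\Pi_{\mathfrak o}\,\mathcal C_Q(M,C)],\qquad M(0)=M_0,$$ is given by $$M(t)=Q_e(t)^\top M_0\,Q_e(t),\quad\text{where}\quad e^{t\,\mathcal C_Q(M_0,C)}=Q_e(t)R_e(t),\quad Q_e(t)\in\mathbf O,\ R_e(t)\in\mathbf{Up}^+$$ is the QR decomposition.
   Context: All matrices are real $n\times n$; $\mathcal M$ is the space of all of them and $[A,B]=AB-BA$. $\mathbf O$ is the orthogonal group, $\mathbf{Up}^+$ the group of upper triangular matrices with positive diagonal, $\mathfrak{lo}$ the space of lower triangular matrices and $\mathfrak{lo}^0$ that of strictly lower triangular matrices. $P_\pi$ is the permutation matrix with $P_\pi e_i=e_{\pi(i)}$, and $D^\pi=P_\pi^\top DP_\pi=\operatorname{diag}(\lambda_{\pi(1)},\dots,\lambda_{\pi(n)})$. $\mathbf{GL}^{\mathrm{pos}}$ and $\mathbf O^{\mathrm{pos}}$ are the sets of invertible, respectively orthogonal, matrices all of whose leading principal minors are positive. $\mathcal U^{\mathbf{GL}}_{D^\pi}=\{X^{-1}D^\pi X : X\in\mathbf{GL}^{\mathrm{pos}}\}$. Each $M\in\mathcal U^{\mathbf{GL}}_{D^\pi}$ can be written uniquely as $M=Q^\top(Y+D^\pi)Q$ with $Q\in\mathbf O^{\mathrm{pos}}$,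 $Y\in\mathfrak{lo}^0$; for $C\in\mathfrak{lo}$ set $\mathcal C_Q(M,C)=Q^\top CQ$ with this $Q$. $\Pi_{\mathfrak o}:\mathcal M\to\mathfrak o$ is the projection associated with the direct sum $\mathcal M=\mathfrak o\oplus\mathfrak{up}$ of skew-symmetric and upper triangular matrices. *)

(* Defs.v *)
From HB Require Import structures.
From mathcomp Require Import all_boot all_order all_algebra all_fingroup.
From mathcomp Require Import all_classical all_reals all_analysis.
Set Implicit Arguments.
Unset Strict Implicit.
Unset Printing Implicit Defensive.
Import Order.TTheory GRing.Theory Num.Theory.
Import numFieldNormedType.Exports.
Local Open Scope classical_set_scope.
Local Open Scope ring_scope.

Section Defs.
Context {R : realType} {n : nat}.
Implicit Types (A B C M X Y Q S T : 'M[R]_n) (pi : 'S_n) (lambda : 'rV[R]_n).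

Definition mx_bracket A B : 'M[R]_n := A *m B - B *m A.

Definition skew_symmetric A : Prop := A^T = - A.
Definition orthogonal_mx Q : Prop := Q^T *m Q = 1%:M.

(* MathComp's [is_trig_mx] means lower triangular. *)
Definition lower_triangular A : Prop := is_trig_mx A.
Definition strictly_lower_triangular A : Prop :=
  forall i j : 'I_n, (i <= j)%N -> A i j = 0.
Definition upper_triangular A : Prop := is_trig_mx A^T.
Definition upper_triangular_pos A : Prop :=
  upper_triangular A /\ forall i : 'I_n, 0 < A i i.

Definition leading_minor A (k : nat) (hk : (k <= n)%N) : R :=
  \det (mxsub (widen_ord hk) (widen_ord hk) A).
Definition pos_leading_minors A : Prop :=
  forall (k : nat) (hk : (k <= n)%N), 0 < leading_minor A hk.

Definition GLpos : set 'M[R]_n :=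
  [set X | X \in unitmx /\ pos_leading_minors X].
Definition Opos : set 'M[R]_n :=
  [set Q | orthogonal_mx Q /\ pos_leading_minors Q].

(* The permutation matrix of the convention P_pi e_i = e_(pi i) on column
   vectors ([perm_mx s] sends e_i to e_(s^-1 i)). *)
Definition permutation_mx pi : 'M[R]_n := perm_mx pi^-1%g.

Definition Dperm lambda pi : 'M[R]_n :=
  (permutation_mx pi)^T *m diag_mx lambda *m permutation_mx pi.

Definition U_GL lambda pi : set 'M[R]_n :=
  [set M | exists2 X, GLpos X & M = invmx X *m Dperm lambda pi *m X].

(* [Q_factor lambda pi M] is the Q in O^pos with M = Q^T (Y + D^pi) Q for some
   strictly lower triangular Y: on [U_GL lambda pi] there is exactly one such
   Q, outside that set the value of [get] is not meaningful. *)
Definition is_Q_factor lambda pi M Q : Prop :=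
  Opos Q /\ exists2 Y, strictly_lower_triangular Y &
              M = Q^T *m (Y + Dperm lambda pi) *m Q.
Definition Q_factor lambda pi M : 'M[R]_n :=
  get [set Q | is_Q_factor lambda pi M Q].

Definition C_Q lambda pi M C : 'M[R]_n :=
  (Q_factor lambda pi M)^T *m C *m Q_factor lambda pi M.

(* The projection onto skew-symmetric matrices along upper triangular ones;
   [Pi_o_skew], [Pi_o_upper] and [Pi_o_unique] show that it is well defined. *)
Definition Pi_o A : 'M[R]_n :=
  get [set S | skew_symmetric S /\ upper_triangular (A - S)].

Definition expmx A : 'M[R]_n :=
  limn (series (fun k => (k`!%:R : R)^-1 *: A ^+ k)).

Definition is_QR A Q T : Prop :=
  [/\ orthogonal_mx Q, upper_triangular_pos T & A = Q *m T].

(* Solutions on a set J of times (used for open intervals, where the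
   derivative is two-sided) of the initial value problem
   M' = [M, Pi_o (C_Q (M, C))], M(0) = M0.  The vector field lives on
   [U_GL lambda pi], so a solution has to stay in that set. *)
Definition is_solution_on lambda pi C M0 (J : set R) (M : R -> 'M[R]_n) :
    Prop :=
  M 0 = M0 /\
  forall t, J t -> U_GL lambda pi (M t) /\
    is_derive t (1 : R) M (mx_bracket (M t) (Pi_o (C_Q lambda pi (M t) C))).

Lemma permutation_mxE pi (i : 'I_n) :
  permutation_mx pi *m delta_mx i (0 : 'I_1) = delta_mx (pi i) 0.
Proof.
apply/matrixP => j k; rewrite !mxE (bigD1 i) //= big1 ?addr0 => [|l /negPf nli].
  by rewrite !mxE eqxx andTb -mulnb natrM (canF_eq (permKV pi)).
by rewrite !mxE nli mulr0.
Qed.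

Lemma DpermE lambda pi :
  Dperm lambda pi = diag_mx (\row_i lambda 0 (pi i)).
Proof.
rewrite /Dperm /permutation_mx tr_perm_mx invgK -row_permE -[LHS]col_permE.
apply/matrixP => i j; rewrite !mxE.
by rewrite (inj_eq perm_inj).
Qed.

Lemma skew_upper_eq0 S : skew_symmetric S -> upper_triangular S -> S = 0.
Proof.
move=> /matrixP skS /is_trig_mxP upS; apply/matrixP => i j; rewrite !mxE.
have lt0 (k l : 'I_n) : (l < k)%N -> S k l = 0 by move=> /upS; rewrite mxE.
have skE (k l : 'I_n) : S k l = - S l k by have := skS l k; rewrite !mxE.
case: (ltngtP i j) => [ij|ji|/ord_inj->]; last 1 first.
- by apply/eqP; rewrite -eqNr -skE.
- by rewrite skE lt0 ?oppr0.
- exact: lt0.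
Qed.

Lemma Pi_oP A : skew_symmetric (Pi_o A) /\ upper_triangular (A - Pi_o A).
Proof.
pose S : 'M[R]_n := \matrix_(i, j)
  if (j < i)%N then A i j else if (i < j)%N then - A j i else 0.
apply: (@getPex _ [set S | skew_symmetric S /\ upper_triangular (A - S)]).
exists S; split.
  apply/matrixP => i j; rewrite !mxE.
  by case: (ltngtP i j) => _; rewrite ?opprK ?oppr0.
by apply/is_trig_mxP => i j ij; rewrite !mxE ij subrr.
Qed.

Lemma Pi_o_skew A : skew_symmetric (Pi_o A).
Proof. by case: (Pi_oP A). Qed.

Lemma Pi_o_upper A : upper_triangular (A - Pi_o A).
Proof. by case: (Pi_oP A). Qed.

Lemma Pi_o_unique A S :
  skew_symmetric S -> upper_triangular (A - S) -> Pi_o A = S.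
Proof.
move=> skS upS; have [skP upP] := Pi_oP A; apply/eqP; rewrite -subr_eq0.
apply/eqP/skew_upper_eq0.
  by rewrite /skew_symmetric linearB /= skS skP opprB opprK addrC.
apply/is_trig_mxP => i j ij.
move/is_trig_mxP: upS => /(_ i j ij); move/is_trig_mxP: upP => /(_ i j ij).
by rewrite !mxE => /subr0_eq <- /subr0_eq <-; rewrite subrr.
Qed.

End Defs.

(* Main.v *)
(** Write M0 = Q0^T (Y + D^pi) Q0 and C0 = Q0^T C Q0.  Differentiating the QR
    factorization exp(t C0) = Qe Re shows Qe' = Qe Pi_o(Qe^T C0 Qe); since
    Q0 exp(t C0) Q0^T is lower triangular with positive diagonal, Q0 Qe stays in
    O^pos, so it is the Q-factor of Qe^T M0 Qe, which therefore solves the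
    equation.

    Conversely, along any solution N the Q-factor Q is differentiable (it comes
    from the LQ factorization of a matrix of eigenrows, obtained from N by
    Lagrange interpolation), and isospectrality forces Q' = Q Pi_o(Q^T C Q).
    Then V = exp(-t C0) Q0^T Q satisfies V' = V U with U upper triangular and
    V(0) = 1.  The orthogonal QR factor of such a V has zero derivative, so V is
    upper triangular with positive diagonal, which identifies Q0^T Q with Qe. *)

Require Import Defs.
From HB Require Import structures.
From mathcomp Require Import all_boot all_order all_algebra all_fingroup.
From mathcomp Require Import all_classical all_reals all_analysis.
Set Implicit Arguments.
Unset Strict Implicit.
Unset Printing Implicit Defensive.
Import Order.TTheory GRing.Theory Num.Theory.
Import numFieldNormedType.Exports.
Local Open Scope classical_set_scope.
Local Open Scope ring_scope.

(** * Lower triangular matrices over a field *)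

Section Triangular.
Context {F : fieldType} {n : nat}.
Implicit Types A B L W X Z : 'M[F]_n.

Lemma trig_mulmx A B : is_trig_mx A -> is_trig_mx B -> is_trig_mx (A *m B).
Proof.
move=> /is_trig_mxP tA /is_trig_mxP tB; apply/is_trig_mxP => i j ij.
rewrite mxE big1 // => l _; have [il|li] := ltnP i l.
  by rewrite tA // mul0r.
by rewrite tB ?mulr0 // (leq_ltn_trans li).
Qed.

Lemma trig_mulmx_diag A B i :
  is_trig_mx A -> is_trig_mx B -> (A *m B) i i = A i i * B i i.
Proof.
move=> /is_trig_mxP tA /is_trig_mxP tB; rewrite mxE (bigD1 i) //= big1 ?addr0//.
move=> l; rewrite neq_ltn => /orP[li|il].
  by rewrite tB // mulr0.
by rewrite tA // mul0r.
Qed.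

Lemma trig_unitmx A : is_trig_mx A ->
  reflect (forall i, A i i != 0) (A \in unitmx).
Proof.
move=> tA; rewrite unitmxE det_trig // unitfE; apply: (iffP idP).
  by move=> /prodf_neq0 h i; exact: h.
by move=> h; apply/prodf_neq0.
Qed.

(** Forward substitution: row [i] of [L *m X] is [L i i] times row [i] of [X] plus a combination of
    earlier rows of [X], which strong induction on [i] handles. *)
Lemma trig_mulmx_cancel L X :
  is_trig_mx L -> L \in unitmx -> is_trig_mx (L *m X) -> is_trig_mx X.
Proof.
move=> tL uL /is_trig_mxP tLX; have /(trig_unitmx tL) dL := uL.
apply/is_trig_mxP => i; have [k] := ubnP (i : nat).
elim: k i => // k IH i ik j ij.
have := tLX i j ij; rewrite mxE (bigD1 i) //= big1 ?addr0 => [/eqP|l].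
  by rewrite mulf_eq0 (negPf (dL i)) => /eqP.
rewrite neq_ltn => /orP[li|il].
  by rewrite (IH l _ j (ltn_trans li ij)) ?mulr0 // (leq_trans li).
by move/is_trig_mxP: tL => ->; rewrite ?mul0r.
Qed.

Lemma trig_invmx L : is_trig_mx L -> L \in unitmx -> is_trig_mx (invmx L).
Proof.
move=> tL uL; apply: (trig_mulmx_cancel tL uL).
by rewrite mulmxV // scalar_mx_is_trig.
Qed.

(** For [i < j] the entry at [i], [j] of [W *m Z - Z' *m W] is [W i j * (Z j j - Z' i i)] plus terms
    in entries of [W] nearer to the top right corner. Induction on the distance [i + (n - j)] to
    that corner kills everything above the diagonal. *)
Lemma trig_intertwine Z Z' W : is_trig_mx Z -> is_trig_mx Z' ->
  (forall i j : 'I_n, (i < j)%N -> Z' i i != Z j j) ->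
  (forall i j : 'I_n, (i < j)%N -> (W *m Z - Z' *m W) i j = 0) ->
  is_trig_mx W.
Proof.
move=> /is_trig_mxP tZ /is_trig_mxP tZ' dZ comm; apply/is_trig_mxP => i j.
have [k] := ubnP (i + (n - j))%N; elim: k i j => // k IH i j ik ij.
have := comm i j ij; rewrite !mxE (bigD1 j) //= [X in _ - X](bigD1 i) //=.
rewrite big1 => [|l /[!neq_ltn]/orP[lj|jl]]; last 2 first.
- by rewrite tZ // mulr0.
- rewrite IH ?mul0r ?(ltn_trans ij) //.
  by rewrite -ltnS (leq_trans _ ik) // ltnS ltn_add2l ltn_sub2l.
rewrite big1 => [|l /[!neq_ltn]/orP[li|il]]; last 2 first.
- rewrite (IH l j) ?mulr0 ?(ltn_trans li) //.
  by rewrite -ltnS (leq_trans _ ik) // ltnS ltn_add2r.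
- by rewrite tZ' // mul0r.
rewrite !addr0 mulrC -mulrBl => /eqP.
rewrite mulf_eq0 subr_eq0 => /orP[/eqP e|/eqP//].
by have := dZ _ _ ij; rewrite e eqxx.
Qed.

End Triangular.

(** * Orthogonal matrices and uniqueness of the QR decomposition *)

Section OrthogonalMatrices.
Context {R : realType} {n : nat}.
Implicit Types A B L M Q S T W X Y : 'M[R]_n.

Lemma orthogonal_mxC Q : orthogonal_mx Q -> Q *m Q^T = 1%:M.
Proof. exact: mulmx1C. Qed.

Lemma orthogonal_tr Q : orthogonal_mx Q -> orthogonal_mx Q^T.
Proof. by rewrite /orthogonal_mx trmxK => /orthogonal_mxC. Qed.

Lemma orthogonal_mul Q S :
  orthogonal_mx Q -> orthogonal_mx S -> orthogonal_mx (Q *m S).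
Proof.
move=> oQ oS; rewrite /orthogonal_mx trmx_mul mulmxA -(mulmxA S^T) oQ.
by rewrite mulmx1.
Qed.

Lemma orthogonal_unitmx Q : orthogonal_mx Q -> Q \in unitmx.
Proof. by move=> /mulmx1_unit[]. Qed.

Lemma upper_triangular_mul A B :
  upper_triangular A -> upper_triangular B -> upper_triangular (A *m B).
Proof. by rewrite /upper_triangular trmx_mul => uA uB; exact: trig_mulmx. Qed.

Lemma upper_triangular_inv T :
  upper_triangular T -> T \in unitmx -> upper_triangular (invmx T).
Proof.
by rewrite /upper_triangular trmx_inv => uT unT; rewrite trig_invmx ?unitmx_tr.
Qed.

Lemma upper_triangular_pos_unit T : upper_triangular_pos T -> T \in unitmx.
Proof.
move=> [uT pT]; rewrite -unitmx_tr; apply/(trig_unitmx uT) => i.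
by rewrite mxE gt_eqF.
Qed.

Lemma upper_triangular_posM A B : upper_triangular_pos A ->
  upper_triangular_pos B -> upper_triangular_pos (A *m B).
Proof.
move=> [uA pA] [uB pB]; split; first exact: upper_triangular_mul.
move=> i; have := trig_mulmx_diag i uB uA.
by rewrite -trmx_mul !mxE => ->; rewrite mulr_gt0.
Qed.

Lemma upper_triangular_posV T :
  upper_triangular_pos T -> upper_triangular_pos (invmx T).
Proof.
move=> upT; have [uT pT] := upT; have unT := upper_triangular_pos_unit upT.
have uV := upper_triangular_inv uT unT; split=> // i.
have := trig_mulmx_diag i uT uV.
rewrite -trmx_mul mulVmx // !mxE eqxx => e.
by rewrite -(pmulr_rgt0 _ (pT i)) -e.
Qed.

Lemma upper_triangular_pos1 : upper_triangular_pos (1%:M : 'M[R]_n).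
Proof.
split=> [|i]; last by rewrite mxE eqxx.
by rewrite /upper_triangular trmx1 scalar_mx_is_trig.
Qed.

(** The inverse of [W] is upper triangular and equals [W^T], so [W] is diagonal; its diagonal
    entries square to 1 and are positive. *)
Lemma orthogonal_upper_pos_eq1 W :
  orthogonal_mx W -> upper_triangular_pos W -> W = 1%:M.
Proof.
move=> oW upW; have [/is_trig_mxP uW pW] := upW.
have /is_trig_mxP lW : is_trig_mx W.
  have iW : invmx W = W^T.
    by rewrite -[LHS]mulmx1 -(orthogonal_mxC oW) mulKmx // orthogonal_unitmx.
  rewrite -[W]trmxK -iW.
  by case: (upper_triangular_posV upW).
have offd (i j : 'I_n) : i != j -> W i j = 0.
  by rewrite neq_ltn => /orP[/lW//|/uW]; rewrite mxE.
apply/matrixP => i j; rewrite mxE; have [<-|/offd//] := eqVneq i j.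
have := congr1 (fun A : 'M[R]_n => A i i) oW.
rewrite mxE (bigD1 i) //= big1 => [|l li]; last by rewrite offd ?mulr0.
rewrite !mxE eqxx addr0 -expr2 => /eqP; rewrite sqrf_eq1 => /orP[/eqP//|/eqP e].
by have := pW i; rewrite e oppr_gt0 ltNge ler01.
Qed.

Lemma is_QR_upper T : upper_triangular_pos T -> is_QR T 1%:M T.
Proof. by move=> uT; split=> //; rewrite /orthogonal_mx ?trmx1 mul1mx. Qed.

(** [Q'^T *m Q = T' *m invmx T] is at once orthogonal and upper triangular with positive diagonal,
    hence the identity. *)
Lemma is_QR_unique A Q T Q' T' :
  is_QR A Q T -> is_QR A Q' T' -> Q = Q' /\ T = T'.
Proof.
move=> [oQ uT ->] [oQ' uT' e].
have unT := upper_triangular_pos_unit uT.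
have W1 : Q'^T *m Q = 1%:M.
  apply: orthogonal_upper_pos_eq1; first exact/orthogonal_mul/oQ/orthogonal_tr.
  suff -> : Q'^T *m Q = T' *m invmx T.
    exact/upper_triangular_posM/upper_triangular_posV.
  by rewrite -[Q in LHS](mulmxK unT) e !mulmxA oQ' mul1mx.
have QQ' : Q = Q' by rewrite -[Q]mul1mx -(orthogonal_mxC oQ') -mulmxA W1 mulmx1.
split=> //; move: e; rewrite QQ' => /(congr1 (mulmx Q'^T)).
by rewrite !mulmxA oQ' !mul1mx.
Qed.

End OrthogonalMatrices.

(** * Leading principal minors of products with triangular matrices *)

Section LeadingMinors.
Context {R : realType} {n : nat}.
Implicit Types A L Q T W X : 'M[R]_n.

Lemma leading_minor_tr A k (hk : (k <= n)%N) :
  leading_minor A^T hk = leading_minor A hk.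
Proof. by rewrite /leading_minor -det_tr trmx_mxsub trmxK. Qed.

(** The first [k] rows of [L] vanish beyond the first [k] columns, so the leading block of the
    product is the product of the leading blocks. *)
Lemma leading_minor_trigM L X k (hk : (k <= n)%N) : is_trig_mx L ->
  leading_minor (L *m X) hk = leading_minor L hk * leading_minor X hk.
Proof.
move=> /is_trig_mxP tL; rewrite /leading_minor -det_mulmx; congr (\det _).
apply/matrixP => i j; rewrite !mxE.
rewrite (bigID (fun l : 'I_n => (l < k)%N)) /= [X in _ + X]big1 => [|l].
  rewrite addr0 (big_ord_narrow hk).
  by apply: eq_bigr => l _; rewrite !mxE.
by rewrite -leqNgt => kl; rewrite tL ?mul0r //= (leq_trans (ltn_ord i)).
Qed.

Lemma leading_minor_upperM X T k (hk : (k <= n)%N) : upper_triangular T ->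
  leading_minor (X *m T) hk = leading_minor X hk * leading_minor T hk.
Proof.
move=> uT; rewrite -leading_minor_tr trmx_mul leading_minor_trigM //.
by rewrite !leading_minor_tr mulrC.
Qed.

Lemma leading_minor_trig L k (hk : (k <= n)%N) : is_trig_mx L ->
  leading_minor L hk = \prod_(i < k) L (widen_ord hk i) (widen_ord hk i).
Proof.
move=> /is_trig_mxP tL; rewrite /leading_minor det_trig.
  by apply: eq_bigr => i _; rewrite mxE.
by apply/is_trig_mxP => i j ij; rewrite mxE tL.
Qed.

Lemma trig_pos_leading_minors L : is_trig_mx L ->
  pos_leading_minors L <-> forall i, 0 < L i i.
Proof.
move=> tL; split=> [pL i|pL k hk]; last first.
  by rewrite leading_minor_trig // prodr_gt0.
(* The entry [L i i] is the quotient of the leading minors of orders [i.+1] and [i]. *)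
have := pL i.+1 (ltn_ord i); rewrite leading_minor_trig // big_ord_recr /=.
have := pL i (ltnW (ltn_ord i)); rewrite leading_minor_trig //.
have -> : widen_ord (ltn_ord i) ord_max = i by exact/val_inj.
rewrite [X in _ -> 0 < X * _ -> _](_ : _ =
  \prod_(l < i) L (widen_ord (ltnW (ltn_ord i)) l)
                  (widen_ord (ltnW (ltn_ord i)) l)).
  by move=> /pmulr_rgt0->.
by apply: eq_bigr => l _; congr (L _ _); apply/val_inj.
Qed.

Lemma pos_leading_minors_unit A : pos_leading_minors A -> A \in unitmx.
Proof.
move=> /(_ n (leqnn n)); rewrite /leading_minor unitmxE unitfE => /gt_eqF.
rewrite (_ : mxsub _ _ A = A) => [->//|].
by apply/matrixP => i j; rewrite mxE; congr (A _ _); apply/val_inj.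
Qed.

Lemma pos_leading_minors_trigM L X : is_trig_mx L -> pos_leading_minors L ->
  pos_leading_minors (L *m X) <-> pos_leading_minors X.
Proof.
move=> tL pL; split=> pX k hk; have := pX k hk; rewrite leading_minor_trigM //.
  by rewrite pmulr_rgt0.
by move=> ?; rewrite mulr_gt0.
Qed.

Lemma upper_pos_leading_minors T :
  upper_triangular_pos T -> pos_leading_minors T.
Proof.
move=> [uT pT] k hk; rewrite -leading_minor_tr leading_minor_trig //.
by apply: prodr_gt0 => i _; rewrite mxE.
Qed.

Lemma pos_leading_minors_upperM X T : upper_triangular_pos T ->
  pos_leading_minors X -> pos_leading_minors (X *m T).
Proof.
move=> uT pX k hk; rewrite leading_minor_upperM; last by case: uT.
by rewrite mulr_gt0 // upper_pos_leading_minors.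
Qed.

End LeadingMinors.

(** * Derivatives of matrix-valued curves, entry by entry *)

Section MatrixDerivatives.
Context {R : realType}.

Lemma is_derive_mxP m n (M : R -> 'M[R]_(m, n)) t D :
  is_derive t (1 : R) M D <->
  forall i j, is_derive t (1 : R) (fun s => M s i j) (D i j).
Proof.
split=> [[dM <-] i j|dM].
  have dij : derivable (fun s => M s i j) t 1 by exact: (derivable_mxP M t 1).1.
  by rewrite derive_mx // mxE; exact: derivableP.
have dM' : derivable M t 1 by apply/derivable_mxP => i j; case: (dM i j).
split=> //; rewrite derive_mx //; apply/matrixP => i j; rewrite mxE.
by case: (dM i j).
Qed.

Lemma derivable_big_sum (I : Type) (r : seq I) (f : I -> R -> R) t :
  (forall i, derivable (f i) t 1) ->
  derivable (fun s => \sum_(i <- r) f i s) t 1.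
Proof.
move=> df; elim: r => [|a r IH].
  by under eq_fun do rewrite big_nil; exact: derivable_cst.
by under eq_fun do rewrite big_cons; exact: derivableD.
Qed.

Lemma derivable_big_prod (I : Type) (r : seq I) (f : I -> R -> R) t :
  (forall i, derivable (f i) t 1) ->
  derivable (fun s => \prod_(i <- r) f i s) t 1.
Proof.
move=> df; elim: r => [|a r IH].
  by under eq_fun do rewrite big_nil; exact: derivable_cst.
by under eq_fun do rewrite big_cons; exact: derivableM.
Qed.

Lemma is_derive_mulmx m n p (A : R -> 'M[R]_(m, n)) (B : R -> 'M[R]_(n, p))
    t dA dB :
  is_derive t (1 : R) A dA -> is_derive t (1 : R) B dB ->
  is_derive t (1 : R) (fun s => A s *m B s) (dA *m B t + A t *m dB).
Proof.
move=> /is_derive_mxP hA /is_derive_mxP hB; apply/is_derive_mxP => i j.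
rewrite !mxE -big_split /=.
have -> : (fun s => (A s *m B s) i j) =
    \sum_(l < n) ((fun s => A s i l) * (fun s => B s l j)).
  by apply/funext => s; rewrite mxE fct_sumE.
apply: is_derive_sum => l; apply: is_derive_eq (is_deriveM (hA i l) (hB l j)) _.
by rewrite /GRing.scale /= [B t l j * _]mulrC addrC.
Qed.

Lemma is_derive_mulmxl m n p (C : 'M[R]_(m, n)) (B : R -> 'M[R]_(n, p)) t dB :
  is_derive t (1 : R) B dB ->
  is_derive t (1 : R) (fun s => C *m B s) (C *m dB).
Proof.
move=> hB; have := is_derive_mulmx (is_derive_cst C t 1) hB.
by rewrite mul0mx add0r.
Qed.

Lemma is_derive_mulmxr m n p (A : R -> 'M[R]_(m, n)) (C : 'M[R]_(n, p)) t dA :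
  is_derive t (1 : R) A dA ->
  is_derive t (1 : R) (fun s => A s *m C) (dA *m C).
Proof.
move=> hA; have := is_derive_mulmx hA (is_derive_cst C t 1).
by rewrite mulmx0 addr0.
Qed.

Lemma is_derive_trmx m n (A : R -> 'M[R]_(m, n)) t dA :
  is_derive t (1 : R) A dA -> is_derive t (1 : R) (fun s => (A s)^T) dA^T.
Proof.
move=> /is_derive_mxP hA; apply/is_derive_mxP => i j; rewrite mxE.
by under eq_fun do rewrite mxE.
Qed.

Lemma derivable_mulmx m n p (A : R -> 'M[R]_(m, n)) (B : R -> 'M[R]_(n, p)) t :
  derivable A t 1 -> derivable B t 1 -> derivable (fun s => A s *m B s) t 1.
Proof.
by move=> /derivableP hA /derivableP hB; case: (is_derive_mulmx hA hB).
Qed.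

Lemma derivable_trmx m n (A : R -> 'M[R]_(m, n)) t :
  derivable A t 1 -> derivable (fun s => (A s)^T) t 1.
Proof. by move=> /derivableP /is_derive_trmx[]. Qed.

Lemma derivable_det n (A : R -> 'M[R]_n) t :
  derivable A t 1 -> derivable (fun s => \det (A s)) t 1.
Proof.
move=> /derivable_mxP dA; apply: derivable_big_sum => s.
apply: derivableM; first exact: derivable_cst.
exact: derivable_big_prod.
Qed.

Lemma near_pos_leading_minors n (A : R -> 'M[R]_n) t : derivable A t 1 ->
  pos_leading_minors (A t) -> \forall s \near t, pos_leading_minors (A s).
Proof.
(* Indexing the minors by ['I_n.+1] leaves finitely many conditions, whose neighbourhoods can be
   intersected. *)
move=> dA pA; suff : \forall s \near t, forall k : 'I_n.+1,
    0 < leading_minor (A s) (ltn_ord k : (k <= n)%N).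
  apply: filterS => s h k hk.
  rewrite (bool_irrelevance hk (ltn_ord (@Ordinal n.+1 k hk))).
  exact: (h (@Ordinal n.+1 k hk)).
suff near_k (k : 'I_n.+1) : \forall s \near t,
    0 < leading_minor (A s) (ltn_ord k : (k <= n)%N).
  exact: filter_forall near_k.
have dm : derivable (fun s => leading_minor (A s) (ltn_ord k : (k <= n)%N)) t 1.
  apply: derivable_det; apply/derivable_mxP => i j.
  by under eq_fun do rewrite mxE; move/derivable_mxP: dA; exact.
have := cvgr_gt _ (differentiable_continuous ((derivable1_diffP _ _).1 dm)).
by apply; exact: pA.
Qed.

Lemma is_derive0_cst (J : set R) (f : R -> R) a b : is_interval J ->
  (forall s, J s -> is_derive s (1 : R) f 0) -> J a -> J b -> f a = f b.
Proof.
move=> iJ df; wlog ab : a b / a <= b.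
  by move=> H Ja Jb; case: (leP a b) => [/H|/ltW/H h]; [exact|exact/esym/h].
move=> Ja Jb; have Js s : a <= s <= b -> J s by exact: iJ.
have [||c _] := @MVT_segment R f (fun=> 0) a b ab.
- by move=> s sab; apply/df/Js; rewrite !ltW ?(itvP sab).
- apply: continuous_in_subspaceT => s /set_mem /= /itvP sab.
  apply: differentiable_continuous; apply/derivable1_diffP.
  by case: (df s (Js s _)) => //; rewrite !sab.
- by rewrite mul0r => /subr0_eq.
Qed.

Lemma is_derive0_mx_cst m n (J : set R) (A : R -> 'M[R]_(m, n)) a b :
  is_interval J -> (forall s, J s -> is_derive s (1 : R) A 0) ->
  J a -> J b -> A a = A b.
Proof.
move=> iJ dA Ja Jb; apply/matrixP => i j.
apply: (@is_derive0_cst J (fun s => A s i j)) => // s /dA /is_derive_mxP.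
by move=> /(_ i j); rewrite mxE.
Qed.

End MatrixDerivatives.

(** * Differentiable Gram-Schmidt orthonormalization *)

Section QR.
Context {R : realType}.

Lemma derivable_row_mx m n1 n2 (A : R -> 'M[R]_(m, n1))
    (B : R -> 'M[R]_(m, n2)) t :
  derivable A t 1 -> derivable B t 1 ->
  derivable (fun s => row_mx (A s) (B s)) t 1.
Proof.
move=> /derivable_mxP dA /derivable_mxP dB; apply/derivable_mxP => i j.
under eq_fun do rewrite mxE.
by case: (fintype.split j) => l; [exact: dA|exact: dB].
Qed.

Lemma derivable_lsubmx m n1 n2 (A : R -> 'M[R]_(m, n1 + n2)) t :
  derivable A t 1 -> derivable (fun s => lsubmx (A s)) t 1.
Proof.
move=> /derivable_mxP dA; apply/derivable_mxP => i j.
under eq_fun do rewrite mxE.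
exact: dA.
Qed.

Lemma derivable_rsubmx m n1 n2 (A : R -> 'M[R]_(m, n1 + n2)) t :
  derivable A t 1 -> derivable (fun s => rsubmx (A s)) t 1.
Proof.
move=> /derivable_mxP dA; apply/derivable_mxP => i j.
under eq_fun do rewrite mxE.
exact: dA.
Qed.

Definition sqnorm m (a : 'cV[R]_m) : R := (a^T *m a) 0 0.

Lemma sqnorm_gt0 m (a : 'cV[R]_m) : a != 0 -> 0 < sqnorm a.
Proof.
have sqE : sqnorm a = \sum_i a i 0 ^+ 2.
  by rewrite /sqnorm mxE; apply: eq_bigr => i _; rewrite mxE expr2.
move=> a0; rewrite lt_neqAle eq_sym sqE sumr_ge0 ?andbT => [|i _]; last first.
  exact: sqr_ge0.
apply: contra a0 => /eqP/psumr_eq0P a0; apply/eqP/matrixP => i j.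
rewrite ord1 mxE; apply/eqP; rewrite -sqrf_eq0 a0 // => l _; exact: sqr_ge0.
Qed.

Definition normalize m (a : 'cV[R]_m) : 'cV[R]_m :=
  (Num.sqrt (sqnorm a))^-1 *: a.

Lemma derivable_normalize m (a : R -> 'cV[R]_m) t : a t != 0 ->
  derivable a t 1 -> derivable (fun s => normalize (a s)) t 1.
Proof.
move=> a0 da; have n0 := sqnorm_gt0 a0.
have dn : derivable (fun s => sqnorm (a s)) t 1.
  exact: ((derivable_mxP _ t 1).1 (derivable_mulmx (derivable_trmx da) da)).
have dsq : derivable (fun s => Num.sqrt (sqnorm (a s))) t 1.
  have [//] := @is_derive1_comp R Num.sqrt (fun s => sqnorm (a s)) t _ _
    (is_derive1_sqrt n0) (derivableP dn).
move/derivable_mxP: da => da; apply/derivable_mxP => i j.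
under eq_fun do rewrite mxE.
apply: (@derivableM _ _ (fun s => (Num.sqrt (sqnorm (a s)))^-1)); last exact: da.
by apply: derivableV dsq; rewrite gt_eqF // sqrtr_gt0.
Qed.

Lemma normalizeK m (a : 'cV[R]_m) : a != 0 ->
  Num.sqrt (sqnorm a) *: normalize a = a.
Proof.
by move=> /sqnorm_gt0 n0; rewrite scalerA mulfV ?scale1r // gt_eqF // sqrtr_gt0.
Qed.

Lemma normalize_orthonormal m (a : 'cV[R]_m) : a != 0 ->
  (normalize a)^T *m normalize a = 1%:M.
Proof.
move=> /sqnorm_gt0 n0; rewrite /normalize -scalemxAr.
rewrite [(_ *: a)^T]linearZ /= -scalemxAl scalerA.
apply/matrixP => i j; rewrite !ord1 [LHS]mxE -/(sqnorm a) -invfM -expr2.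
by rewrite sqr_sqrtr ?ltW // mulVf ?gt_eqF // mxE.
Qed.

(** Linear independence of the columns, as a trivial kernel, so that it covers the rectangular
    matrices met in the Gram-Schmidt recursion. *)
Definition col_free m k (A : 'M[R]_(m, k)) : Prop :=
  forall x : 'cV[R]_k, A *m x = 0 -> x = 0.

(* One step of Gram-Schmidt splits off the first column, so that the block
   decomposition of widths [1 + k] is definitional. *)
Lemma gram_schmidt m k : exists2 q : 'M[R]_(m, k) -> 'M[R]_(m, k),
  forall A, col_free A -> (q A)^T *m q A = 1%:M /\
    exists2 T, upper_triangular_pos T & A = q A *m T
  & forall (A : R -> 'M[R]_(m, k)) t, col_free (A t) ->
      derivable A t 1 -> derivable (fun s => q (A s)) t 1.
Proof.
elim: k => [|k [q qP dq]].
  exists id => // A _; split; first by apply/matrixP => -[].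
  exists 1%:M; first exact: upper_triangular_pos1.
  by rewrite mulmx1.
(* [u] is the unit vector along the first column, and [B] the other columns minus their components
   along [u]. *)
pose u (A : 'M[R]_(m, 1 + k)) := normalize (lsubmx A).
pose B (A : 'M[R]_(m, 1 + k)) := rsubmx A - u A *m ((u A)^T *m rsubmx A).
have l0 (A : 'M[R]_(m, 1 + k)) : col_free A -> lsubmx A != 0.
  move=> fA; apply/eqP => lA0.
  have := fA (col_mx 1%:M 0); rewrite -{1}[A]hsubmxK mul_row_col lA0 mul0mx mulmx0.
  rewrite addr0 => /(_ erefl) /(congr1 usubmx); rewrite col_mxKu linear0.
  by move/matrixP/(_ 0 0)/eqP; rewrite !mxE eqxx oner_eq0.
have Bfree (A : 'M[R]_(m, 1 + k)) : col_free A -> col_free (B A).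
  move=> fA x Bx.
  (* With this coefficient for the first column, [A *m col_mx y x = B A *m x], so a kernel vector of
     [B A] extends to one of [A]. *)
  pose y : 'M[R]_1 := - (Num.sqrt (sqnorm (lsubmx A)))^-1 *:
    ((u A)^T *m rsubmx A *m x).
  have := fA (col_mx y x); rewrite -{1}[A]hsubmxK mul_row_col.
  have -> : lsubmx A *m y = - (u A *m ((u A)^T *m rsubmx A) *m x).
    rewrite /y -scalemxAr scaleNr; congr (- _).
    by rewrite [X in _ = X *m _ *m _]/u /normalize -!scalemxAl -[in RHS]mulmxA.
  rewrite addrC -mulmxBl => /(_ Bx) /(congr1 dsubmx).
  by rewrite col_mxKd linear0.
exists (fun A => row_mx (u A) (q (B A))) => [A fA|A t fA dA].
  have [oq [T1 upT1 BE]] := qP _ (Bfree _ fA); 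
  have uu : (u A)^T *m u A = 1%:M by exact: normalize_orthonormal (l0 _ fA).
  have uB : (u A)^T *m B A = 0.
    by rewrite /B mulmxBr [X in _ - X]mulmxA uu mul1mx subrr.
  (* The columns of [q (B A)] are combinations of those of [B A], all orthogonal to [u A]. *)
  have uq : (u A)^T *m q (B A) = 0.
    rewrite -[q _](mulmxK (upper_triangular_pos_unit upT1)) -BE mulmxA uB.
    by rewrite mul0mx.
  have qu : (q (B A))^T *m u A = 0.
    by rewrite -[LHS]trmxK trmx_mul trmxK uq trmx0.
  split.
    have : (row_mx (u A) (q (B A)))^T *m row_mx (u A) (q (B A)) = 1%:M.
      by rewrite tr_row_mx mul_col_row uu uq oq qu -scalar_mx_block.
    exact.
  pose c := Num.sqrt (sqnorm (@lsubmx R m 1 k A)).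
  pose T := block_mx c%:M ((u A)^T *m @rsubmx R m 1 k A) 0 T1.
  have [uT1 pT1] := upT1.
  have uT : is_trig_mx T^T.
    by rewrite tr_block_mx is_trig_block_mx // trmx0 eqxx mx11_is_trig.
  have pT (i : 'I_(1 + k)) : 0 < T i i.
    case: (split_ordP i) => {}i ->; last by rewrite block_mxEdr.
    by rewrite block_mxEul ord1 mxE eqxx sqrtr_gt0 sqnorm_gt0 // l0.
  have AE : (A : 'M[R]_(m, 1 + k)) = row_mx (u A) (q (B A)) *m T.
    rewrite mul_row_block mulmx0 addr0 -BE mul_mx_scalar normalizeK ?l0 //.
    by rewrite addrC subrK hsubmxK.
  by exists T.
have du : derivable (fun s => u (A s)) t 1.
  apply: derivable_normalize; first exact: l0.
  exact: (@derivable_lsubmx m 1 k A).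
have dr : derivable (fun s => @rsubmx R m 1 k (A s)) t 1.
  exact: derivable_rsubmx.
have dB : derivable (fun s => B (A s)) t 1.
  exact: (derivableB dr
    (derivable_mulmx du (derivable_mulmx (derivable_trmx du) dr))).
exact: (@derivable_row_mx m 1 k _ _ t du (dq _ _ (Bfree _ fA) dB)).
Qed.

End QR.

(** * The orthogonal QR factor along a curve *)

Section QRFlow.
Context {R : realType} {n : nat}.
Implicit Types (A B Q T U V : 'M[R]_n).

(** One fixed Gram-Schmidt function, extracted by choice so that it can be differentiated along
    curves; its values are controlled on invertible matrices. *)
Definition qr_Q : 'M[R]_n -> 'M[R]_n := s2val (cid2 (@gram_schmidt R n n)).

Lemma unitmx_col_free A : A \in unitmx -> col_free A.
Proof. by move=> uA x Ax; rewrite -[x](mulKmx uA) Ax mulmx0. Qed.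

Lemma is_QR_qr_Q A : A \in unitmx -> is_QR A (qr_Q A) ((qr_Q A)^T *m A).
Proof.
move=> /unitmx_col_free fA.
have [oQ [T uT AE]] := s2valP (cid2 (@gram_schmidt R n n)) A fA.
rewrite -/qr_Q in oQ AE.
by have -> : (qr_Q A)^T *m A = T by rewrite [X in _ *m X = _]AE mulmxA oQ mul1mx.
Qed.

Lemma derivable_qr_Q (A : R -> 'M[R]_n) t : A t \in unitmx ->
  derivable A t 1 -> derivable (fun s => qr_Q (A s)) t 1.
Proof.
move=> /unitmx_col_free; exact: (s2valP' (cid2 (@gram_schmidt R n n))).
Qed.

(** Differentiate [Q^T *m Q = 1], which holds near [t]. *)
Lemma skew_derivative (Q : R -> 'M[R]_n) t dQ :
  (\forall s \near t, orthogonal_mx (Q s)) ->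
  is_derive t (1 : R) Q dQ -> skew_symmetric ((Q t)^T *m dQ).
Proof.
move=> oQ hQ; have h := is_derive_mulmx (is_derive_trmx hQ) hQ.
have h0 : is_derive t (1 : R) (fun s => (Q s)^T *m Q s) 0.
  apply: near_eq_is_derive (is_derive_cst (1%:M : 'M[R]_n) t 1).
  by apply: filterS oQ => s ->.
have : dQ^T *m Q t + (Q t)^T *m dQ = 0.
  by rewrite -[LHS](@derive_val _ _ _ _ _ _ _ h) (@derive_val _ _ _ _ _ _ _ h0).
by move=> /eqP; rewrite addr_eq0 /skew_symmetric trmx_mul trmxK => /eqP.
Qed.

Lemma upper_derivative (T : R -> 'M[R]_n) t dT :
  (\forall s \near t, upper_triangular (T s)) ->
  is_derive t (1 : R) T dT -> upper_triangular dT.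
Proof.
move=> uT /is_derive_mxP hT; apply/is_trig_mxP => i j ij; rewrite mxE.
have h0 : is_derive t (1 : R) (fun s => T s j i) 0.
  apply: near_eq_is_derive (is_derive_cst (0 : R) t 1).
  by apply: filterS uT => s /is_trig_mxP/(_ i j ij); rewrite mxE.
by rewrite -(@derive_val _ _ _ _ _ _ _ (hT j i)) (@derive_val _ _ _ _ _ _ _ h0).
Qed.

(* Differentiating A = Q T gives Q^T A' T^-1 = Q^T Q' + T' T^-1, a
   skew-symmetric plus an upper triangular matrix. *)
Lemma is_derive_qr_Q (A : R -> 'M[R]_n) t dA :
  (\forall s \near t, A s \in unitmx) -> is_derive t (1 : R) A dA ->
  let Q := qr_Q (A t) in
  is_derive t (1 : R) (fun s => qr_Q (A s))
    (Q *m Pi_o (Q^T *m dA *m invmx (Q^T *m A t))).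
Proof.
move=> uA hA Q; have uAt := nbhs_singleton uA.
have dQ : derivable (fun s => qr_Q (A s)) t 1.
  by apply: derivable_qr_Q => //; case: hA.
have hQ := derivableP dQ; set dQt := 'D_1 _ t in hQ.
have hT := is_derive_mulmx (is_derive_trmx hQ) hA; set dT := _ + _ in hT.
have hA' := is_derive_mulmx hQ hT.
have [oQ uT AE] := is_QR_qr_Q uAt; rewrite -/Q in oQ uT AE.
have dAE : dA = dQt *m (Q^T *m A t) + Q *m dT.
  rewrite -[LHS](@derive_val _ _ _ _ _ _ _ hA).
  rewrite -[RHS](@derive_val _ _ _ _ _ _ _ hA').
  apply: near_eq_derive; apply: filterS uA => s /is_QR_qr_Q[_ _].
  by [].
have unT := upper_triangular_pos_unit uT.
have sk : skew_symmetric (Q^T *m dQt).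
  by apply: skew_derivative hQ; apply: filterS uA => s /is_QR_qr_Q[].
have up : upper_triangular dT.
  by apply: upper_derivative hT; apply: filterS uA => s /is_QR_qr_Q[_ []].
apply: is_derive_eq hQ _; rewrite (Pi_o_unique sk) => [|].
  by rewrite mulmxA orthogonal_mxC // mul1mx.
rewrite dAE mulmxDr mulmxDl !mulmxA oQ mul1mx.
rewrite -[X in upper_triangular (X + _ - _)]mulmxA.
rewrite -(mulmxA Q^T dQt) -!mulmxA.
rewrite [X in upper_triangular (_ *m (_ *m X) + _ - _)]mulmxA.
rewrite mulmxA mulmxV // mulmx1 addrAC subrr add0r.
exact/upper_triangular_mul/upper_triangular_inv/unT/(proj1 uT).
Qed.

(** Write [V = Q *m T]. Then [Q^T *m V' *m invmx T = T *m U *m invmx T] is upper triangular, so its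
    skew part is zero and [Q] is constant. It starts at the identity, which leaves [V = T]. *)
Lemma upper_flow (J : set R) (U V : R -> 'M[R]_n) :
  open J -> is_interval J -> J 0 -> upper_triangular_pos (V 0) ->
  (forall t, J t -> [/\ V t \in unitmx, upper_triangular (U t) &
     is_derive t (1 : R) V (V t *m U t)]) ->
  forall t, J t -> upper_triangular_pos (V t).
Proof.
move=> oJ iJ J0 upV0 hV t Jt.
have cstQ : qr_Q (V t) = qr_Q (V 0).
  apply: (is_derive0_mx_cst (A := fun s => qr_Q (V s)) iJ) => // s Js.
  have [uV uU dV] := hV s Js; have [oQ [uT _] VE] := is_QR_qr_Q uV.
  have unT : (qr_Q (V s))^T *m V s \in unitmx.
    by rewrite unitmx_mul unitmx_tr uV orthogonal_unitmx.
  apply: is_derive_eq (is_derive_qr_Q _ dV) _.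
    by apply: filterS (oJ s Js) => r /hV[].
  rewrite (@Pi_o_unique _ _ _ 0) ?mulmx0 //.
    by rewrite /skew_symmetric trmx0 oppr0.
  rewrite subr0 !mulmxA; apply: upper_triangular_mul (upper_triangular_inv uT unT).
  exact: upper_triangular_mul.
have Q0 : qr_Q (V 0) = 1%:M.
  have [uV0 _ _] := hV 0 J0.
  by case: (is_QR_unique (is_QR_qr_Q uV0) (is_QR_upper upV0)).
have [uV _ _] := hV t Jt; have [_ upT] := is_QR_qr_Q uV.
by rewrite cstQ Q0 mul1mx => ->; move: upT; rewrite cstQ Q0 trmx1 !mul1mx.
Qed.

End QRFlow.

(** * The matrix exponential as a matrix of scalar power series *)

Section MatrixExponential.
Context {R : realType} {n : nat}.
Implicit Types A : 'M[R]_n.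

Lemma cvg_mx_entries m p (F : nat -> 'M[R]_(m, p)) (L : 'M[R]_(m, p)) :
  (forall i j, F k i j @[k --> \oo] --> L i j) -> F @ \oo --> L.
Proof.
move=> FL; apply/cvgrPdist_le => e e0; near=> k.
rewrite /Num.Def.normr /= mx_normrE (bigmax_le _ (ltW e0)) //= => i _.
rewrite !mxE; move: i; near: k; apply: filter_forall => /= i.
exact: ((cvgrPdist_le _ _).1 (FL i.1 i.2)).
Unshelve. all: by end_near. Qed.

(** Coefficients of the power series in [t] for one entry of [expmx (t *: A)]. *)
Let c A i j : R^nat := fun k => (k`!%:R)^-1 * (A ^+ k) i j.

(** Summing over all entries, rather than taking their maximum, bounds powers of [A] with no factor
    depending on [n]. *)
Let absbound A : R := \sum_(p : 'I_n * 'I_n) `|A p.1 p.2|.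

Let exprmx_bound A k i j : `|(A ^+ k) i j| <= absbound A ^+ k.
Proof.
elim: k i j => [|k IH] i j.
  by rewrite !expr0 !mxE; case: (i == j); rewrite ?normr1 // normr0.
rewrite !exprS mxE (le_trans (ler_norm_sum _ _ _)) //.
under eq_bigr do rewrite normrM.
apply: (@le_trans _ _ (\sum_l `|A i l| * absbound A ^+ k)).
  by apply: ler_sum => l _; rewrite ler_wpM2l.
rewrite -mulr_suml ler_wpM2r ?exprn_ge0 ?sumr_ge0 //.
rewrite /absbound -(pair_bigA _ (fun a b => `|A a b|)) /=.
rewrite [leRHS](bigD1 i) //= lerDl.
by rewrite sumr_ge0 // => l _; rewrite sumr_ge0.
Qed.

(** Comparison with the scalar exponential series at [absbound A] times the modulus of [x]. *)
Let cvg_c A i j x : cvgn (pseries (c A i j) x).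
Proof.
apply: normed_cvg.
apply: (series_le_cvg _ _ _ (is_cvg_series_exp_coeff (absbound A * `|x|))) => k /=.
- by [].
- by apply: exp_coeff_ge0; rewrite mulr_ge0 ?sumr_ge0.
rewrite /exp_coeff /c /= !normrM normrX exprMn.
rewrite [`|_^-1|]ger0_norm ?invr_ge0 // [leRHS]mulrC mulrA.
by rewrite ler_wpM2r ?exprn_ge0 // ler_wpM2l ?invr_ge0.
Qed.

(** In the formal derivative [k.+1] cancels against the factorial, and one factor [A] is split off
    on the left; [diffs_cr] splits it off on the right. *)
Let diffs_cl A i j : pseries_diffs (c A i j) =
  fun k => \sum_l A i l * c A l j k.
Proof.
apply/funext => k; rewrite /pseries_diffs /c factS natrM invfM !mulrA mulfV //.
rewrite mul1r exprS mxE mulr_sumr; apply: eq_bigr => l _.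
by rewrite mulrCA.
Qed.

Let diffs_cr A i j : pseries_diffs (c A i j) =
  fun k => \sum_l c A i l k * A l j.
Proof.
apply/funext => k; rewrite /pseries_diffs /c factS natrM invfM !mulrA mulfV //.
rewrite mul1r exprSr mxE mulr_sumr; apply: eq_bigr => l _.
by rewrite mulrA.
Qed.

Let cvg_comb (a : 'I_n -> R) (b : 'I_n -> R^nat) x :
  (forall l, cvgn (pseries (b l) x)) ->
  pseries (fun k => \sum_l a l * b l k) x @ \oo -->
    \sum_l a l * limn (pseries (b l) x).
Proof.
move=> cb.
rewrite (_ : pseries _ _ = fun N => \sum_l a l * pseries (b l) x N); last first.
  apply/funext => N; rewrite /pseries /series /=.
  under [RHS]eq_bigr do rewrite mulr_sumr.
  rewrite exchange_big /=; apply: eq_bigr => k _; rewrite mulr_suml.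
  by apply: eq_bigr => l _; rewrite mulrA.
apply: cvg_big => [|l _]; first exact: add_continuous.
exact: (cvgM (cvg_cst (a l)) (cb l)).
Qed.

Lemma expmxE A t i j : expmx (t *: A) i j = limn (pseries (c A i j) t).
Proof.
have -> : expmx (t *: A) = \matrix_(i, j) limn (pseries (c A i j) t).
  apply: cvg_lim; first exact: norm_hausdorff.
  apply: cvg_mx_entries => a b; rewrite mxE.
  rewrite (_ : (fun k => _) = pseries (c A a b) t); first exact: cvg_c.
  apply/funext => N; rewrite /pseries /series /= summxE; apply: eq_bigr => k _.
  rewrite !mxE /c -mulrA; congr (_ * _).
  have -> : (t *: A) ^+ k = t ^+ k *: A ^+ k.
    elim: k => [|k IH]; first by rewrite !expr0 scale1r.
    by rewrite !exprS IH -[LHS]scalemxAl -[X in _ *: X]scalemxAr scalerA.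
  by rewrite mxE mulrC.
by rewrite mxE.
Qed.

Lemma expmx0 : expmx (0 : 'M[R]_n) = 1%:M.
Proof.
apply: cvg_lim; first exact: norm_hausdorff.
(* The partial sum of index 0 is empty; from index 1 on it is the degree-zero term alone. *)
apply: cvg_near_cst; exists 1%N => // -[//|k] _.
rewrite /series /= big_nat_recl // expr0 fact0 invr1 scale1r big1 ?addr0 // => l _.
by rewrite exprS mul0r scaler0.
Qed.

Let lim_diffs_l A t i j :
  limn (pseries (pseries_diffs (c A i j)) t) = (A *m expmx (t *: A)) i j.
Proof.
rewrite diffs_cl; apply: cvg_lim => //; rewrite mxE.
by under [X in _ --> X]eq_bigr do rewrite expmxE; apply: cvg_comb.
Qed.

Let lim_diffs_r A t i j :
  limn (pseries (pseries_diffs (c A i j)) t) = (expmx (t *: A) *m A) i j.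
Proof.
rewrite diffs_cr; apply: cvg_lim => //; rewrite mxE.
under [X in _ --> X]eq_bigr do rewrite expmxE mulrC.
under [X in pseries X]eq_fun do under eq_bigr do rewrite mulrC.
exact: cvg_comb.
Qed.

(** Both products are the sum of the same differentiated series, with the factor [A] split off on
    either side. *)
Lemma expmx_comm A t : A *m expmx (t *: A) = expmx (t *: A) *m A.
Proof. by apply/matrixP => i j; rewrite -lim_diffs_l lim_diffs_r. Qed.

Lemma is_derive_expmx A t :
  is_derive t (1 : R) (fun s => expmx (s *: A)) (A *m expmx (t *: A)).
Proof.
apply/is_derive_mxP => i j; rewrite -lim_diffs_l.
under eq_fun do rewrite expmxE.
have cvg_diffs a b x : cvgn (pseries (pseries_diffs (c A a b)) x).
  by rewrite diffs_cl; apply: cvgP; apply: cvg_comb => l; exact: cvg_c.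
(* Termwise differentiation at [t] asks for convergence of the series and of its first two formal
   derivatives at a point of larger modulus. *)
apply: (@pseries_snd_diffs R (c A i j) (`|t| + 1)) => //.
- have -> : pseries_diffs (pseries_diffs (c A i j)) =
      fun k => \sum_l A i l * pseries_diffs (c A l j) k.
    apply/funext => k; rewrite {1}/pseries_diffs diffs_cl mulr_sumr.
    by apply: eq_bigr => l _; rewrite mulrCA.
  by apply: cvgP; apply: cvg_comb => l; exact: cvg_diffs.
- by rewrite [ltRHS]ger0_norm ?addr_ge0 // ltrDl.
Qed.

(** The product has zero derivative in [t], because [A] commutes with its exponentials, so it keeps
    its value at 0. *)
Lemma expmxN A t : expmx (- t *: A) *m expmx (t *: A) = 1%:M.
Proof.
have hN s : is_derive s (1 : R) (fun r => expmx (- r *: A))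
    (- (A *m expmx (- s *: A))).
  under eq_fun do rewrite scaleNr -scalerN.
  apply: is_derive_eq (is_derive_expmx (- A) s) _.
  by rewrite scalerN -scaleNr mulNmx.
have cst0 : expmx (- t *: A) *m expmx (t *: A) =
    expmx (- 0 *: A) *m expmx (0 *: A).
  apply: (is_derive0_mx_cst (J := setT)
    (A := fun s => expmx (- s *: A) *m expmx (s *: A))) => // s _.
  apply: is_derive_eq (is_derive_mulmx (hN s) (is_derive_expmx A s)) _.
  by rewrite (expmx_comm A (- s)) mulNmx mulmxA addNr.
by rewrite cst0 oppr0 scale0r expmx0 mul1mx.
Qed.

Lemma expmx_unit A t : expmx (t *: A) \in unitmx.
Proof. by have /mulmx1_unit[] := expmxN A t. Qed.

End MatrixExponential.

(** * The Q-factor: uniqueness, existence and differentiability *)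

Section QFactor.
Context {R : realType} {n : nat}.
Variables (lambda : 'rV[R]_n) (pi : 'S_n).
Implicit Types C G L M Q S W X Y Z : 'M[R]_n.

Let d i : R := lambda 0 (pi i).

Hypothesis lambda_inj : forall i j : 'I_n, (i < j)%N -> lambda 0 j < lambda 0 i.

Lemma spectrum_perm_neq i j : i != j -> d i != d j.
Proof.
move=> ij; have : pi i != pi j by rewrite (inj_eq perm_inj).
by rewrite /d neq_ltn => /orP[]/lambda_inj; [rewrite eq_sym|]; move/lt_eqF->.
Qed.

Lemma strictly_lower_add_Dperm Z :
  (exists2 Y, strictly_lower_triangular Y & Z = Y + Dperm lambda pi) <->
  is_trig_mx Z /\ forall i, Z i i = d i.
Proof.
rewrite DpermE; split=> [[Y sY ->]|[/is_trig_mxP tZ dZ]].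
  split=> [|i]; last by rewrite !mxE eqxx sY // add0r.
  apply/is_trig_mxP => i j ij.
  by rewrite !mxE sY 1?ltnW // -val_eqE ltn_eqF // addr0.
exists (Z - diag_mx (\row_i lambda 0 (pi i))); last by rewrite subrK.
move=> i j; rewrite leq_eqVlt => /orP[/eqP/val_inj<-|ij].
  by rewrite !mxE eqxx dZ subrr.
by rewrite !mxE tZ // -val_eqE ltn_eqF // subr0.
Qed.

(** Solving for the middle factor gives [Y + D^pi = Q *m M *m Q^T], which turns the existential over
    [Y] into a condition on entries. *)
Lemma is_Q_factorE M Q : is_Q_factor lambda pi M Q <->
  Opos Q /\ is_trig_mx (Q *m M *m Q^T) /\ forall i, (Q *m M *m Q^T) i i = d i.
Proof.
have conj Z : orthogonal_mx Q -> M = Q^T *m Z *m Q <-> Z = Q *m M *m Q^T.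
  move=> oQ; split=> ->; first by
    rewrite !mulmxA orthogonal_mxC // mul1mx -mulmxA orthogonal_mxC ?mulmx1.
  by rewrite !mulmxA oQ mul1mx -mulmxA oQ mulmx1.
rewrite -strictly_lower_add_Dperm; split=> -[[oQ pQ] [Y sY e]]; split=> //.
  by exists Y => //; apply/esym/conj.
by exists Y => //; apply/conj.
Qed.

(** [W = Q' *m Q^T] intertwines two lower triangular matrices with the same diagonal of distinct
    entries, so [W] is lower triangular. Comparing minors in [Q' = W *m Q] makes its diagonal
    positive, and being orthogonal it is the identity. *)
Lemma Q_factor_unique M Q Q' :
  is_Q_factor lambda pi M Q -> is_Q_factor lambda pi M Q' -> Q = Q'.
Proof.
move=> /is_Q_factorE[[oQ pQ] [tZ dZ]] /is_Q_factorE[[oQ' pQ'] [tZ' dZ']].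
set W := Q' *m Q^T.
have oW : orthogonal_mx W by exact/orthogonal_mul/orthogonal_tr.
have WQ : W *m Q = Q' by rewrite -mulmxA oQ mulmx1.
have tW : is_trig_mx W.
  apply: (trig_intertwine tZ tZ') => i j ij.
    by rewrite dZ dZ' spectrum_perm_neq // neq_ltn ij.
  suff -> : W *m (Q *m M *m Q^T) = Q' *m M *m Q'^T *m W by rewrite subrr mxE.
  by rewrite /W !mulmxA -(mulmxA Q') oQ mulmx1 -(mulmxA (Q' *m M)) oQ' mulmx1.
have pW : pos_leading_minors W.
  move=> k hk; have := pQ' k hk; rewrite -WQ leading_minor_trigM //.
  by rewrite pmulr_lgt0.
have /(congr1 trmx) : W^T = 1%:M.
  apply: orthogonal_upper_pos_eq1; first exact: orthogonal_tr.
  split=> [|i]; first by rewrite /upper_triangular trmxK.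
  by rewrite mxE; exact: (trig_pos_leading_minors tW).1.
by rewrite trmxK trmx1 -WQ => ->; rewrite mul1mx.
Qed.

Lemma Q_factorE M Q : is_Q_factor lambda pi M Q -> Q_factor lambda pi M = Q.
Proof.
move=> MQ; apply: Q_factor_unique (MQ).
by apply: (@getPex _ [set Q | is_Q_factor lambda pi M Q]); exists Q.
Qed.

(** The LQ factorization, by transposing QR. The factor [L] multiplies leading minors by positive
    numbers, so the orthogonal factor inherits positivity from [X]. *)
Lemma qr_Q_tr_pos X : pos_leading_minors X ->
  pos_leading_minors (qr_Q X^T)^T /\
  exists2 L, is_trig_mx L /\ (forall i, 0 < L i i) & X = L *m (qr_Q X^T)^T.
Proof.
move=> pX; have uX : X^T \in unitmx by rewrite unitmx_tr pos_leading_minors_unit.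
have [oQ uT XE] := is_QR_qr_Q uX; set T := _ *m X^T in uT XE.
have LX : X = T^T *m (qr_Q X^T)^T by rewrite -trmx_mul -XE trmxK.
have lT : is_trig_mx T^T by case: uT.
have pT i : 0 < T^T i i by rewrite mxE; case: uT.
split; last by exists T^T.
by apply/(pos_leading_minors_trigM _ lT); [apply/trig_pos_leading_minors|rewrite -LX].
Qed.

(** With [X = L *m Q], conjugation by [Q] yields [invmx L *m D^pi *m L], lower triangular with the
    diagonal of [D^pi]. *)
Lemma is_Q_factor_GLpos X : pos_leading_minors X ->
  is_Q_factor lambda pi (invmx X *m Dperm lambda pi *m X) (qr_Q X^T)^T.
Proof.
move=> pX; have uX := pos_leading_minors_unit pX.
have [pQ [L [tL pL] XE]] := qr_Q_tr_pos pX.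
set Q := (qr_Q X^T)^T in pQ XE *; apply/is_Q_factorE.
have oQ : orthogonal_mx Q.
  by apply: orthogonal_tr; case: (@is_QR_qr_Q _ _ X^T) => //; rewrite unitmx_tr.
have uL : L \in unitmx by apply/(trig_unitmx tL) => i; rewrite gt_eqF.
have tD : is_trig_mx (Dperm lambda pi) by rewrite DpermE diag_mx_is_trig.
have tV := trig_invmx tL uL.
split=> //.
have -> : Q *m (invmx X *m Dperm lambda pi *m X) *m Q^T =
    invmx L *m Dperm lambda pi *m L.
  have -> : invmx X = Q^T *m invmx L.
    apply: (can_inj (mulKmx uX)); rewrite mulmxV // {1}XE -mulmxA.
    by rewrite [Q *m _]mulmxA orthogonal_mxC // mul1mx mulmxV.
  rewrite [in LHS]XE !mulmxA orthogonal_mxC // mul1mx -(mulmxA _ Q).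
  by rewrite orthogonal_mxC // mulmx1.
have tVD := trig_mulmx tV tD; split=> [|i]; first exact: trig_mulmx.
rewrite (trig_mulmx_diag i tVD tL) (trig_mulmx_diag i tV tD) mulrAC.
rewrite -(trig_mulmx_diag i tV tL) mulVmx // mxE eqxx mul1r.
by rewrite DpermE !mxE eqxx.
Qed.

Lemma U_GL_is_Q_factor M : U_GL lambda pi M ->
  is_Q_factor lambda pi M (Q_factor lambda pi M).
Proof.
move=> [X [_ pX] ->]; have XQ := is_Q_factor_GLpos pX.
by rewrite (Q_factorE XQ).
Qed.

Lemma U_GL_orthogonal_conj M S : U_GL lambda pi M -> orthogonal_mx S ->
  pos_leading_minors (Q_factor lambda pi M *m S) ->
  U_GL lambda pi (S^T *m M *m S) /\
  Q_factor lambda pi (S^T *m M *m S) = Q_factor lambda pi M *m S.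
Proof.
move=> MU oS pQS; have MQ := U_GL_is_Q_factor MU; split; last first.
  have [[oQ _] [Y sY ME]] := MQ; apply: Q_factorE; split.
    by split=> //; exact: orthogonal_mul.
  by exists Y => //; rewrite trmx_mul {1}ME !mulmxA.
(* The new conjugating matrix is [X *m S = L *m (Q *m S)] with [Q] the Q-factor of [M], so its
   leading minors are positive. *)
have [X [uX pX] ME] := MU; exists (X *m S).
  split; first by rewrite unitmx_mul uX orthogonal_unitmx.
  have [_ [L [tL pL] XE]] := qr_Q_tr_pos pX.
  rewrite XE -mulmxA; apply/(pos_leading_minors_trigM _ tL).
    exact/trig_pos_leading_minors.
  by rewrite -(Q_factorE (is_Q_factor_GLpos pX)) -ME.
have -> : invmx (X *m S) = S^T *m invmx X.
  have uXS : X *m S \in unitmx by rewrite unitmx_mul uX orthogonal_unitmx.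
  apply: (can_inj (mulKmx uXS)); rewrite mulmxV // -mulmxA [S *m _]mulmxA.
  by rewrite orthogonal_mxC // mul1mx mulmxV.
by rewrite ME !mulmxA.
Qed.

Lemma derivable_mx_prod (I : Type) (r : seq I) (P : pred I)
    (f : I -> R -> 'M[R]_n) t : (forall i, derivable (f i) t 1) ->
  derivable (fun s => \prod_(i <- r | P i) f i s) t 1.
Proof.
move=> df; elim: r => [|a r IH].
  by under eq_fun do rewrite big_nil; exact: derivable_cst.
under eq_fun do rewrite big_cons.
by case: (P a); [exact: derivable_mulmx (df a) IH|exact: IH].
Qed.

Lemma diag_mx_prod (I : Type) (r : seq I) (P : pred I) (F : 'I_n -> I -> R) :
  diag_mx (\row_k \prod_(i <- r | P i) F k i) =
  \prod_(i <- r | P i) diag_mx (\row_k F k i).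
Proof.
elim: r => [|a r IH]; rewrite ?big_nil ?big_cons.
  by apply/matrixP => k l; rewrite !mxE big_nil.
case: ifP => Pa.
  rewrite -IH -[RHS]/(_ *m _) mulmx_diag; congr diag_mx.
  by apply/rowP => k; rewrite !mxE big_cons Pa.
by rewrite -IH; congr diag_mx; apply/rowP => k; rewrite !mxE big_cons Pa.
Qed.

Lemma prod_conj (I : Type) (r : seq I) (P : pred I) (f : I -> 'M[R]_n) X :
  X \in unitmx -> \prod_(i <- r | P i) (invmx X *m f i *m X) =
  invmx X *m (\prod_(i <- r | P i) f i) *m X.
Proof.
move=> uX; elim: r => [|a r IH]; rewrite ?big_nil ?big_cons.
  by rewrite mulmx1 mulVmx.
rewrite IH; case: ifP => // _; rewrite -[LHS]/(_ *m _) -[f a * _]/(_ *m _).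
by rewrite !mulmxA -(mulmxA _ X) mulmxV // mulmx1.
Qed.

(* The coefficients of the rows of X0 along the i-th eigenline of N, obtained
   with the Lagrange polynomial of D that vanishes at all d j with j != i. *)
Let eigenrows X0 (N : 'M[R]_n) : 'M[R]_n := \matrix_(i, l)
  ((\prod_(j | j != i) (d i - d j))^-1 *
   (X0 *m \prod_(j | j != i) (N - (d j)%:M)) i l).

(** At this argument the Lagrange product is a multiple of [invmx X *m E_ii *m X], with [E_ii] the
    diagonal matrix unit, so row [i] of [X] comes out scaled by [(X0 *m invmx X) i i]. *)
Let eigenrowsE X0 X : X \in unitmx ->
  eigenrows X0 (invmx X *m Dperm lambda pi *m X) =
  diag_mx (\row_i (X0 *m invmx X) i i) *m X.
Proof.
move=> uX; apply/matrixP => i l.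
rewrite mul_diag_mx [RHS]mxE [in RHS]mxE [LHS]mxE.
have -> : \prod_(j | j != i) (invmx X *m Dperm lambda pi *m X - (d j)%:M) =
    invmx X *m diag_mx (\row_k \prod_(j | j != i) (d k - d j)) *m X.
  rewrite diag_mx_prod -prod_conj //; apply: eq_bigr => j _.
  have -> : diag_mx (\row_k (d k - d j)) = Dperm lambda pi - (d j)%:M.
    rewrite DpermE; apply/matrixP => a b; rewrite !mxE.
    by case: (a == b); rewrite ?subr0.
  by rewrite mulmxBr mulmxBl mul_mx_scalar -scalemxAl mulVmx // scalemx1.
rewrite !mulmxA mul_mx_diag; set B := X0 *m invmx X; rewrite [X in _ * X = _]mxE.
rewrite [X in _ * X = _](bigD1 i) //= [X in _ * (_ + X) = _]big1 ?addr0 => [|k ki].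
  rewrite !mxE mulrA [X in X * _]mulrCA mulVf ?mulr1 //.
  by apply/prodf_neq0 => j ji; rewrite subr_eq0 spectrum_perm_neq // eq_sym.
by rewrite mxE [X in _ * X * _]mxE (bigD1 k) //= subrr mul0r mulr0 mul0r.
Qed.

(** Choose [X0] conjugating [D^pi] to [N t]. The eigenrow matrix [X s] is polynomial in [N s] and
    equals [X0] at [s = t], so near [t] it has positive leading minors and conjugates [D^pi] to
    [N s]. The orthogonal part of its LQ factorization is then the Q-factor. *)
Lemma derivable_Q_factor (N : R -> 'M[R]_n) t :
  (\forall s \near t, U_GL lambda pi (N s)) -> derivable N t 1 ->
  derivable (fun s => Q_factor lambda pi (N s)) t 1.
Proof.
move=> NU dN; have [X0 [uX0 pX0] NtE] := nbhs_singleton NU.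
pose X s := eigenrows X0 (N s).
have dX : derivable X t 1.
  apply/derivable_mxP => i l; rewrite /X.
  under eq_fun do rewrite mxE.
  have dP : derivable (fun s => \prod_(j | j != i) (N s - (d j)%:M)) t 1.
    apply: derivable_mx_prod => j.
    exact: derivableB dN (derivable_cst _ _ _).
  have /derivable_mxP/(_ i l) := derivable_mulmx (derivable_cst X0 t 1) dP.
  exact: derivableM (derivable_cst _ _ _).
have XtE : X t = X0.
  rewrite /X NtE eigenrowsE // mulmxV //.
  rewrite (_ : \row_i _ = const_mx 1) ?diag_const_mx ?mul1mx //.
  by apply/rowP => i; rewrite !mxE eqxx.
have pX : \forall s \near t, pos_leading_minors (X s).
  by apply: near_pos_leading_minors dX _; rewrite XtE.
have QE : \forall s \near t, (qr_Q (X s)^T)^T = Q_factor lambda pi (N s).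
  near=> s; have [Xs [uXs _] NsE] : U_GL lambda pi (N s) by near: s.
  have pXs : pos_leading_minors (X s) by near: s.
  apply/esym/Q_factorE; suff {1}-> : N s = invmx (X s) *m Dperm lambda pi *m X s.
    exact: is_Q_factor_GLpos.
  have uX := pos_leading_minors_unit pXs.
  (* [X s] is a diagonal matrix times [Xs], and diagonal matrices commute with [D^pi]. *)
  apply: (can_inj (mulKmx uX)); rewrite !mulmxA mulmxV // mul1mx.
  rewrite -/(Dperm lambda pi) /X NsE eigenrowsE // DpermE !mulmxA.
  by rewrite -(mulmxA _ Xs) mulmxV // mulmx1 diag_mxC.
apply: (near_eq_derivable QE); apply/derivable_trmx/derivable_qr_Q; last 1 first.
  exact: derivable_trmx.
by rewrite XtE unitmx_tr.
Unshelve. all: by end_near. Qed.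

End QFactor.

(** * The QR flow solves the equation *)

Section QRFlowSolution.
Context {R : realType} {n : nat}.
Variables (lambda : 'rV[R]_n) (pi : 'S_n) (C M0 : 'M[R]_n).
Hypothesis lambda_decr :
  forall i j : 'I_n, (i < j)%N -> lambda 0 j < lambda 0 i.
Hypothesis M0_U : U_GL lambda pi M0.

Let Q0 := Q_factor lambda pi M0.
Let C0 := C_Q lambda pi M0 C.
Let E t := expmx (t *: C0).
Let Qe t := qr_Q (E t).
Let Re t := (Qe t)^T *m E t.

Let Q0_is := U_GL_is_Q_factor lambda_decr M0_U.

Let oQ0 : orthogonal_mx Q0.
Proof. by case: Q0_is => -[]. Qed.

Let QRe t : is_QR (E t) (Qe t) (Re t).
Proof. exact/is_QR_qr_Q/expmx_unit. Qed.

Let oQe t : orthogonal_mx (Qe t).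
Proof. by case: (QRe t). Qed.

Let Qe0 : Qe 0 = 1%:M.
Proof.
have := QRe 0; rewrite {1}/E scale0r expmx0 => QR0.
by case: (is_QR_unique QR0 (is_QR_upper (@upper_triangular_pos1 R n))).
Qed.

(* Q0 exp(t C0) Q0^T = exp(t C) stays lower triangular with positive diagonal,
   so that Q0 Qe = (Q0 exp(t C0) Q0^T) Q0 Re^-1 keeps positive leading minors. *)
Lemma pos_leading_minors_Q0Qe t :
  lower_triangular C -> pos_leading_minors (Q0 *m Qe t).
Proof.
move=> lC; pose F s := Q0 *m E s *m Q0^T.
(* [F' = C *m F], so the transpose has derivative [F^T *m C^T] with [C^T] upper triangular. *)
have FtU : upper_triangular_pos (F t)^T.
  apply: (@upper_flow _ _ setT (fun=> C^T) (fun s => (F s)^T)) => //.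
  - exact: openT.
  - rewrite /F /E scale0r expmx0 mulmx1 orthogonal_mxC // trmx1.
    exact: upper_triangular_pos1.
  - move=> s _; split.
    + by rewrite unitmx_tr !unitmx_mul unitmx_tr orthogonal_unitmx // expmx_unit.
    + by rewrite /upper_triangular trmxK.
    + rewrite -trmx_mul; apply: is_derive_trmx.
      apply: is_derive_eq (is_derive_mulmxr _
        (is_derive_mulmxl _ (is_derive_expmx _ _))) _.
      by rewrite /F /C0 /C_Q -/Q0 !mulmxA orthogonal_mxC // mul1mx.
have lF : is_trig_mx (F t).
  by have [] := FtU; rewrite /upper_triangular trmxK.
have pF : pos_leading_minors (F t).
  apply/(trig_pos_leading_minors lF) => i.
  by have [_ /(_ i)] := FtU; rewrite mxE.
have [_] := QRe t; move: (Re t) => T upT EE.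
have uT := upper_triangular_pos_unit upT.
have -> : Q0 *m Qe t = F t *m (Q0 *m invmx T).
  rewrite /F EE !mulmxA -(mulmxA _ Q0^T) oQ0 mulmx1.
  by rewrite -(mulmxA _ T) mulmxV // mulmx1.
apply/(pos_leading_minors_trigM _ lF pF).
apply: pos_leading_minors_upperM; first exact: upper_triangular_posV.
by case: Q0_is => -[].
Qed.

(** The Q-factor at time [t] is [Q0 *m Qe t], so the matrix to be projected is [Qe^T *m C0 *m Qe].
    It equals [Qe^T *m (C0 *m E) *m invmx Re], whose projection drives [Qe]; skewness of the
    projection turns the derivative of the conjugation into the bracket. *)
Lemma QR_flow_is_solution : lower_triangular C ->
  is_solution_on lambda pi C M0 setT (fun t => (Qe t)^T *m M0 *m Qe t).
Proof.
move=> lC; split; first by rewrite Qe0 trmx1 mul1mx mulmx1.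
move=> t _; have pQ := pos_leading_minors_Q0Qe t lC.
have [MU QM] := U_GL_orthogonal_conj lambda_decr M0_U (oQe t) pQ.
split=> //; rewrite /C_Q QM -/Q0.
set S := Pi_o _.
have SE : S = Pi_o ((Qe t)^T *m (C0 *m E t) *m invmx (Re t)).
  have [_] := QRe t; move: (Re t) => T /upper_triangular_pos_unit uT EE.
  rewrite /S; congr Pi_o; rewrite EE !mulmxA -(mulmxA _ T) mulmxV // mulmx1.
  by rewrite /C0 /C_Q -/Q0 trmx_mul ?mulmxA.
have hQe : is_derive t (1 : R) Qe (Qe t *m S).
  rewrite SE; apply: is_derive_qr_Q (is_derive_expmx _ _).
  by near=> s; exact: expmx_unit.
apply: is_derive_eq
  (is_derive_mulmx (is_derive_mulmxr _ (is_derive_trmx hQe)) hQe) _.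
by rewrite trmx_mul (Pi_o_skew _) /mx_bracket -/S !mulNmx addrC !mulmxA.
Unshelve. all: by end_near. Qed.

(** * Every solution on an open interval around 0 is the QR flow *)

Section Uniqueness.
Variables (J : set R) (N : R -> 'M[R]_n).
Hypotheses (oJ : open J) (iJ : is_interval J) (J0 : J 0).
Hypothesis solN : is_solution_on lambda pi C M0 J N.

Let Q t := Q_factor lambda pi (N t).
Let S t := Pi_o (C_Q lambda pi (N t) C).

Let Q_is t : J t -> is_Q_factor lambda pi (N t) (Q t).
Proof. by move=> /solN.2[/(U_GL_is_Q_factor lambda_decr)]. Qed.

Let oQ t : J t -> orthogonal_mx (Q t).
Proof. by move=> /Q_is[[]]. Qed.

(* In Z = Q N Q^T the eigenvalues stay on the diagonal; writing G for the skew
   matrix Q' Q^T - Q S Q^T, Z' = [G, Z] is strictly lower triangular, hence G is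
   lower triangular and vanishes. *)
Lemma Q_factor_flow t : J t ->
  is_derive t (1 : R) Q (Q t *m S t) /\
  is_derive t (1 : R) (fun s => Q s *m N s *m (Q s)^T) 0.
Proof.
move=> Jt; have [NU hN] := solN.2 t Jt; have nearJ := oJ Jt.
have dQ : derivable Q t 1.
  apply: (derivable_Q_factor lambda_decr); last by case: hN.
  by apply: filterS nearJ => s /solN.2[].
have hQ := derivableP dQ; set Q' := 'D_1 Q t in hQ.
have QQt := orthogonal_mxC (oQ Jt).
pose G := Q' *m (Q t)^T - Q t *m S t *m (Q t)^T.
have skS : (S t)^T = - S t by exact: Pi_o_skew.
have skG : skew_symmetric G.
  have : skew_symmetric ((Q t)^T^T *m Q'^T).
    apply: skew_derivative (is_derive_trmx hQ).
    by apply: filterS nearJ => s /oQ /orthogonal_tr.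
  rewrite /skew_symmetric !trmx_mul !trmxK => skQ'.
  have QQ' : Q t *m Q'^T = - (Q' *m (Q t)^T) by rewrite skQ' opprK.
  rewrite /G linearB /= !trmx_mul trmxK QQ' skS mulNmx mulmxN opprK opprB.
  by rewrite addrC mulmxA.
have Q'E : Q' = G *m Q t + Q t *m S t.
  by rewrite /G mulmxBl -!mulmxA oQ // !mulmx1 subrK.
have Q'tE : Q'^T = - ((Q t)^T *m G) - S t *m (Q t)^T.
  by rewrite Q'E linearD /= !trmx_mul skG skS mulmxN mulNmx.
clearbody G; set Z := fun s => Q s *m N s *m (Q s)^T.
have hZ : is_derive t (1 : R) Z (G *m Z t - Z t *m G).
  apply: is_derive_eq
    (is_derive_mulmx (is_derive_mulmx hQ hN) (is_derive_trmx hQ)) _.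
  (* After inserting [Q' = G *m Q + Q *m S], the terms with [S] cancel against the bracket of [N]
     and [S], leaving that of [G] and [Z]. *)
  rewrite -/(S t) /mx_bracket Q'tE Q'E /Z.
  rewrite !(mulmxDl, mulmxDr, mulmxBl, mulmxBr, mulmxN, mulNmx, mulmxA).
  move: (G *m _ *m _ *m _) (Q t *m S t *m _ *m _)
    (Q t *m N t *m S t *m _) => a b c.
  by rewrite [c - b]addrC [X in X + _]addrA addrK addrA [LHS]addrAC addrK.
have ZE s : J s -> is_trig_mx (Z s) /\ forall i, Z s i i = lambda 0 (pi i).
  by move=> /Q_is/is_Q_factorE[].
have G0 : G = 0.
  have [tZ dZ] := ZE t Jt.
  suff tG : is_trig_mx G.
    apply: skew_upper_eq0 => //; rewrite /upper_triangular skG.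
    by apply/is_trig_mxP => i j ij; rewrite mxE (is_trig_mxP tG) // oppr0.
  apply: (trig_intertwine tZ tZ) => i j ij.
    by rewrite !dZ spectrum_perm_neq // neq_ltn ij.
  have h0 : is_derive t (1 : R) (fun s => Z s i j) 0.
    apply: near_eq_is_derive (is_derive_cst (0 : R) t 1).
    by apply: filterS nearJ => s /ZE[/is_trig_mxP tZs _]; rewrite tZs.
  have /is_derive_mxP/(_ i j) hZij := hZ.
  by rewrite -(@derive_val _ _ _ _ _ _ _ hZij) (@derive_val _ _ _ _ _ _ _ h0).
split; first by apply: is_derive_eq hQ _; rewrite Q'E G0 mul0mx add0r.
by apply: is_derive_eq hZ _; rewrite G0 mul0mx mulmx0 subrr.
Qed.

(** [V' = V *m (S - C_Q (N, C))], and the second factor is upper triangular by the choice of the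
    projection. So [V] stays upper triangular with positive diagonal, and
    [E t = (Q0^T *m Q t) *m invmx (V t)] is the QR decomposition. *)
Lemma Q_factor_QR t : J t -> Q0^T *m Q t = Qe t.
Proof.
move=> Jt; pose V s := expmx (- s *: C0) *m (Q0^T *m Q s).
have upV : upper_triangular_pos (V t).
  apply: (@upper_flow _ _ J (fun s => S s - C_Q lambda pi (N s) C) V) => //.
    rewrite /V oppr0 scale0r expmx0 mul1mx /Q solN.1 -/Q0 oQ0.
    exact: upper_triangular_pos1.
  move=> s Js; split.
  - by rewrite !unitmx_mul expmx_unit unitmx_tr !orthogonal_unitmx //; exact: oQ.
  - have /is_trig_mxP u := Pi_o_upper (C_Q lambda pi (N s) C).
    apply/is_trig_mxP => i j ij; have := u i j ij; rewrite !mxE => /subr0_eq ->.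
    by rewrite subrr.
  - have hE : is_derive s (1 : R) (fun r => expmx (- r *: C0))
        (- (expmx (- s *: C0) *m C0)).
      under eq_fun do rewrite scaleNr -scalerN.
      apply: is_derive_eq (is_derive_expmx (- C0) s) _.
      by rewrite scalerN -scaleNr mulNmx expmx_comm.
    have [hQ _] := Q_factor_flow Js.
    apply: is_derive_eq (is_derive_mulmx hE (is_derive_mulmxl Q0^T hQ)) _.
    rewrite mulmxBr addrC mulNmx; congr (_ - _); first by rewrite /V !mulmxA.
    have -> : C_Q lambda pi (N s) C = (Q s)^T *m C *m Q s by [].
    rewrite /V; move: (expmx _) => E'; have -> : C0 = Q0^T *m C *m Q0 by [].
    have QQ := orthogonal_mxC (oQ Js); move: (Q s) QQ => Qs QQ.
    rewrite !mulmxA -(mulmxA _ Q0) orthogonal_mxC // mulmx1.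
    by rewrite -(mulmxA _ Qs) QQ mulmx1.
have uV := upper_triangular_pos_unit upV.
have [] // := @is_QR_unique _ _ (E t) (Q0^T *m Q t) (invmx (V t)) (Qe t) (Re t).
split; first exact/orthogonal_mul/oQ/Jt/orthogonal_tr.
  exact: upper_triangular_posV.
apply: (can_inj (mulmxK uV)); rewrite mulmxKV //.
have EN : E t *m expmx (- t *: C0) = 1%:M.
  by have := expmxN C0 (- t); rewrite opprK.
by rewrite [_ *m V t]mulmxA EN mul1mx.
Qed.

(** [Q *m N *m Q^T] keeps its initial value [Q0 *m M0 *m Q0^T]; solving for [N] leaves a conjugation
    by [Q0^T *m Q], which is [Qe]. *)
Lemma QR_flow_unique t : J t -> N t = (Qe t)^T *m M0 *m Qe t.
Proof.
move=> Jt; have Zcst : Q t *m N t *m (Q t)^T = Q0 *m M0 *m Q0^T.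
  rewrite (is_derive0_mx_cst (A := fun s => Q s *m N s *m (Q s)^T) iJ _ Jt J0).
    by rewrite /Q solN.1.
  by move=> s /Q_factor_flow[].
rewrite -Q_factor_QR // trmx_mul trmxK !mulmxA.
have -> : (Q t)^T *m Q0 *m M0 *m Q0^T *m Q t =
    (Q t)^T *m (Q0 *m M0 *m Q0^T) *m Q t.
  by rewrite !mulmxA.
by rewrite -Zcst !mulmxA oQ // mul1mx -mulmxA oQ // mulmx1.
Qed.

End Uniqueness.

End QRFlowSolution.

Theorem proposition5p5 (R : realType) (n : nat) (lambda : 'rV[R]_n)
    (pi : 'S_n) (C M0 : 'M[R]_n) :
  (forall i j : 'I_n, (i < j)%N -> lambda 0 j < lambda 0 i) ->
  lower_triangular C ->
  U_GL lambda pi M0 ->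
  exists Qe Re : R -> 'M[R]_n,
    let M := fun t : R => (Qe t)^T *m M0 *m Qe t in
    [/\ forall (t : R) (Q T : 'M[R]_n),
          is_QR (expmx (t *: C_Q lambda pi M0 C)) Q T <->
          Q = Qe t /\ T = Re t,
        is_solution_on lambda pi C M0 setT M
      & forall (J : set R) (N : R -> 'M[R]_n),
          open J -> is_interval J -> J 0 ->
          is_solution_on lambda pi C M0 J N ->
          forall t : R, J t -> N t = M t].
Proof.
move=> lambda_decr lC M0_U.
have QRe t := is_QR_qr_Q (expmx_unit (C_Q lambda pi M0 C) t).
(* The two witnesses are left open and determined by unification with [QRe]. *)
eexists; eexists; split=> [t Q T||J N oJ iJ J0 solN t Jt].
- by split=> [QR|[-> ->]]; [exact: is_QR_unique QR (QRe t)|exact: QRe].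
- exact: QR_flow_is_solution.
- exact: (QR_flow_unique lambda_decr M0_U oJ iJ J0 solN Jt).
Qed.
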